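(* Let $\{P_j\}_{j\in\mathbb{N}_0}$ be a system of selfadjoint projections in a Hilbert space $\mathscr{H}$. For all $n\in\mathbb{N}_0$, set $$T_n=(1-P_n)(1-P_{n-1})\cdots(1-P_0),$$ $$Q_n=P_n(1-P_{n-1})\cdots(1-P_0),\qquad Q_0=P_0.$$ Then, for all $n\in\mathbb{N}_0$, $$1-T_n^*T_n=\sum_{j=0}^n Q_j^*Q_j\qquad\text{and}\qquad 1-T_n=\sum_{j=0}^n Q_j.$$
   Context: $\mathbb{N}_0=\{0,1,2,\dots\}$. A selfadjoint projection is an operator $P:\mathscr{H}\to\mathscr{H}$ with $P=P^*=P^2$. The symbol $1$ denotes the identity operator on $\mathscr{H}$. The projections are not assumed to commute. *)

(* Defs.v *)
From HB Require Import structures.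
From mathcomp Require Import all_boot all_order all_algebra.
From mathcomp Require Import all_classical all_reals all_analysis.
From mathcomp Require Import complex.
Set Implicit Arguments.
Unset Strict Implicit.
Unset Printing Implicit Defensive.
Import Order.TTheory GRing.Theory Num.Theory.
Import numFieldNormedType.Exports.
Local Open Scope classical_set_scope.
Local Open Scope ring_scope.

(* A Hilbert space may be real or complex; [conj] is the involution with
   respect to which its inner product is sesquilinear. *)
Variant scalar_field (R : realType) :
    forall K : numFieldType, (K -> K) -> Prop :=
| RealScalars : @scalar_field R R idfun
| ComplexScalars : @scalar_field R R[i] (fun z => Num.conj z).

Section Operators.
Context (K : numFieldType) (H : completeNormedModType K) (conj : K -> K).
Variable dot : {dot H for conj}.

Definition bounded_operator (T : H -> H) : Prop :=
  linear T /\ exists M : K, forall x, `|T x| <= M * `|x|.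

Definition is_adjoint (T S : H -> H) : Prop :=
  forall x y, dot (T x) y = dot x (S y).

(* By the Riesz representation theorem every bounded operator has an adjoint;
   it is unique (is_adjoint_adjoint), and the default value 0 is only reached
   by maps that have none. *)
Definition adjoint (T : H -> H) : H -> H := xget 0 (is_adjoint T).

Lemma is_adjoint_adjoint (T S : H -> H) : is_adjoint T S -> adjoint T = S.
Proof.
move=> TS; apply: xget_unique => // S' TS'; apply/funext => y.
apply/eqP; rewrite -subr_eq0; apply/negPn/negP => nz.
have := @neq0_dnorm_gt0 _ _ _ dot _ nz.
by rewrite linearBr /= -TS -TS' subrr ltxx.
Qed.

Definition selfadjoint_projection (P : H -> H) : Prop :=
  [/\ bounded_operator P, P = adjoint P & P = P \o P].

End Operators.

Section Products.
Context (K : numFieldType) (H : completeNormedModType K).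
Variable P : nat -> H -> H.

Fixpoint T (n : nat) : H -> H :=
  if n is m.+1 then (idfun - P n) \o T m else idfun - P 0%N.

Definition Q (n : nat) : H -> H :=
  if n is m.+1 then P n \o T m else P 0%N.

End Products.

(* Main.v *)
Require Import Defs.
From mathcomp Require Import all_boot all_order all_algebra.
From mathcomp Require Import all_classical all_reals all_analysis.
Set Implicit Arguments.
Unset Strict Implicit.
Unset Printing Implicit Defensive.
Import Order.TTheory GRing.Theory Num.Theory.
Import numFieldNormedType.Exports.
Local Open Scope ring_scope.

(** Both identities telescope.  With [U] standing for the product of the first
    factors, the next terms are [(1 - P) U] and [P U], whose sum is [U]; so each
    [Q_j] is the difference of two consecutive [T]'s, the first difference
    starting from the identity.  For the quadratic identity, the ranges of [P]
    and [1 - P] are orthogonal, hence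
    [((1 - P) U)^* ((1 - P) U) + (P U)^* (P U) = U^* U]
    ([adjoint_pythagoras]), and [Q_j^* Q_j] is again a difference of
    consecutive terms.

    The point that needs care is that [adjoint] is a choice function with a
    junk value, so the rule [(P U)^* = U^* P] may only be applied to operators
    for which an adjoint has been exhibited.  A projection is its own adjoint
    ([selfadjoint_projectionP]), and each [T_n] then has as adjoint the product
    of the same factors in reverse order ([T_has_adjoint]). *)

Section Adjoints.
Context (K : numFieldType) (H : completeNormedModType K) (conj : K -> K).
Variable dot : {dot H for conj}.
Implicit Types A B P U V : H -> H.

(** Nondegeneracy of the inner product: a vector orthogonal to itself
    vanishes, which is applied to [u - v]. *)
Lemma dot_inj (u v : H) : (forall x, dot x u = dot x v) -> u = v.
Proof.
move=> uv; apply/eqP; rewrite -subr_eq0; apply/negPn/negP => nz.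
have := @neq0_dnorm_gt0 _ _ _ dot _ nz.
by rewrite linearBr /= uv subrr ltxx.
Qed.

(** Additivity comes for free, since [V] is determined by its inner products
    with all vectors. *)
Lemma is_adjointB U V : is_adjoint dot U V -> {morph V : x y / x - y}.
Proof.
move=> UV x y; apply: dot_inj => z.
by rewrite linearBr /= -!UV linearBr.
Qed.

Lemma is_adjoint_comp A B U V :
  is_adjoint dot A B -> is_adjoint dot U V -> is_adjoint dot (A \o U) (V \o B).
Proof. by move=> AB UV x y; rewrite /= AB UV. Qed.

Lemma is_adjoint_compl P :
  is_adjoint dot P P -> is_adjoint dot (idfun - P) (idfun - P).
Proof.
move=> PP x y; rewrite !fctE /= linearBl linearBr /=.
by rewrite PP.
Qed.

(** The equation [P = adjoint dot P] does not by itself say that [P] has an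
    adjoint.  If it had none, [P] would be the default value 0, which is
    selfadjoint all the same. *)
Lemma selfadjoint_projectionP P : selfadjoint_projection dot P ->
  is_adjoint dot P P /\ forall x, P (P x) = P x.
Proof.
case=> _ Padj PP; split; last by move=> x; rewrite [in RHS]PP.
rewrite {2}Padj /adjoint; case: xgetP => [V _ //|noadj].
have P0 : P = 0 by rewrite Padj /adjoint; case: xgetP => // V _ /noadj.
by case: (noadj P); rewrite P0 => x y; rewrite linear0l linear0r.
Qed.

(** The Pythagorean identity [|P u|^2 + |(1 - P) u|^2 = |u|^2] in operator
    form, with [u = U x]: both [P] and [1 - P] are selfadjoint idempotents, so
    the left-hand side is [U^* P U] and the right-hand side is
    [U^* U - U^* (1 - P) U]. *)
Lemma adjoint_pythagoras P U V :
    selfadjoint_projection dot P -> is_adjoint dot U V ->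
  adjoint dot (P \o U) \o (P \o U)
    = (adjoint dot U \o U)
      - (adjoint dot ((idfun - P) \o U) \o ((idfun - P) \o U)).
Proof.
move=> /selfadjoint_projectionP[Psa PP] UV.
rewrite (is_adjoint_adjoint UV) (is_adjoint_adjoint (is_adjoint_comp Psa UV)).
rewrite (is_adjoint_adjoint (is_adjoint_comp (is_adjoint_compl Psa) UV)).
apply/funext => x; rewrite !fctE /= PP (is_adjointB Psa) PP subrr subr0.
by rewrite (is_adjointB UV) subKr.
Qed.

Lemma T_has_adjoint (P : nat -> H -> H) :
    (forall j, selfadjoint_projection dot (P j)) ->
  forall n, exists V, is_adjoint dot (T P n) V.
Proof.
move=> hP.
have cP j : is_adjoint dot (idfun - P j) (idfun - P j).
  by apply: is_adjoint_compl; case/selfadjoint_projectionP: (hP j).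
elim=> [|n [V TV]]; first by exists (idfun - P 0%N); exact: cP.
by exists (V \o (idfun - P n.+1)); apply: is_adjoint_comp.
Qed.

End Adjoints.

Theorem theorem3p5 (R : realType) (K : numFieldType) (conj : K -> K)
    (KE : scalar_field R conj)
    (H : completeNormedModType K) (dot : {dot H for conj})
    (dotE : forall x : H, `|x| ^+ 2 = dot x x)
    (P : nat -> H -> H)
    (hP : forall j, selfadjoint_projection dot (P j)) (n : nat) :
  idfun - (adjoint dot (T P n) \o T P n)
    = \sum_(j < n.+1) (adjoint dot (Q P j) \o Q P j)
  /\ idfun - T P n = \sum_(j < n.+1) Q P j.
Proof.
split; elim: n => [|n IHn]; rewrite big_ord_recr /=.
- have id_adj : is_adjoint dot idfun idfun by [].
  (* The empty product [idfun] plays the part of [T] before index 0. *)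
  have := adjoint_pythagoras (hP 0%N) id_adj.
  by rewrite (is_adjoint_adjoint id_adj) big_ord0 add0r => ->.
- have [V TV] := T_has_adjoint hP n.
  by rewrite -IHn (adjoint_pythagoras (hP n.+1) TV) addrA subrK.
- by rewrite big_ord0 add0r subKr.
- rewrite -IHn; apply/funext => x; rewrite !fctE /=.
  by rewrite opprB addrCA addrC.
Qed.
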